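(* For each integer $n\ge 1$ let $d_{\max}$ be the largest gap between $n$ independent uniform random points on a circle of perimeter one. Then, as $n\to\infty$, the random variable $n\,d_{\max}-\log n$ converges in law to a standard Gumbel distribution with location parameter zero and scale one.
   Context: For each $n$, let $X_1,\ldots,X_n$ be independent random variables, uniformly distributed on $[0,1]$, interpreted as locations of $n$ points on a circle with perimeter one. Let $d_1,\ldots,d_n$ be the arc-length distances between (cyclically) adjacent points: with order statistics $X_{(1)}\le\cdots\le X_{(n)}$, $d_i=X_{(i+1)}-X_{(i)}$ for $1\le i\le n-1$ and $d_n=1+X_{(1)}-X_{(n)}$. Put $d_{\max}=\max_{1\le i\le n} d_i$ (which depends on $n$). The standard Gumbel distribution (location zero, scale one) has distribution function $x\mapsto \exp(-\mathrm{e}^{-x})$, $x\in\mathbb{R}$. *)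

(* Defs.v *)
From HB Require Import structures.
From mathcomp Require Import all_boot all_order all_algebra.
From mathcomp Require Import all_classical all_reals all_analysis.
From mathcomp Require Import measurable_realfun.

Set Implicit Arguments.
Unset Strict Implicit.
Unset Printing Implicit Defensive.
Import Order.TTheory GRing.Theory Num.Theory.
Import numFieldNormedType.Exports.
Local Open Scope classical_set_scope.
Local Open Scope ring_scope.

(* Mutual independence of a finite family of random variables, as the product
   rule over every subfamily. *)
Definition mutually_independent (R : realType) (I : finType)
    (d d' : measure_display) (T : measurableType d) (T' : measurableType d')
    (P : probability T R) (X : I -> {RV P >-> T'}) : Prop :=
  forall (J : {set I}) (A : I -> set T'),
    (forall i, i \in J -> measurable (A i)) ->
    (P (\bigcap_(i in [set` J]) (X i @^-1` A i)) =
     \prod_(i in J) P (X i @^-1` A i))%E.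

(* The two laws are compared on measurable sets only, since both sides also
   have junk values on non-measurable sets. *)
Definition uniform01_distributed (R : realType) (d : measure_display)
    (T : measurableType d) (P : probability T R) (X : {RV P >-> R}) : Prop :=
  forall A : set R, measurable A ->
    distribution P X A = uniform_prob (@ltr01 R) A.

(* Convergence in law: pointwise convergence of the distribution functions at
   every continuity point of the limit distribution function. The variables
   may live on different probability spaces. *)
Definition cvg_in_law (R : realType) (d : nat -> measure_display)
    (T : forall n, measurableType (d n)) (P : forall n, probability (T n) R)
    (Y : forall n, {RV (P n) >-> R}) (mu : probability (measurableTypeR R) R)
    : Prop :=
  forall x : R, {for x, continuous (fun r : R => mu `]-oo, r]%classic)} ->
    cdf (Y n) x @[n --> \oo] --> mu `]-oo, x]%classic.
Arguments cvg_in_law {R d T} P Y mu.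

Section gumbel.
Context {R : realType}.

Definition gumbel_cdf (x : R) : R := expR (- expR (- x)).

Let gumbel_cdf_nd : nondecreasing gumbel_cdf.
Proof. by move=> x y xy; rewrite /gumbel_cdf ler_expR lerN2 ler_expR lerN2. Qed.

Let gumbel_cdf_continuous : continuous gumbel_cdf.
Proof.
move=> x; apply: continuous_comp; last exact: continuous_expR.
apply: continuousN; apply: continuous_comp; last exact: continuous_expR.
exact: opp_continuous.
Qed.

Let gumbel_cdf_rc : right_continuous gumbel_cdf.
Proof. exact: right_continuousW. Qed.

HB.instance Definition _ :=
  isCumulative.Build R _ R gumbel_cdf gumbel_cdf_nd gumbel_cdf_rc.

Let gumbel_cdf_Ny : gumbel_cdf @ -oo --> (0 : R).
Proof.
have expRy : @expR R x @[x --> +oo] --> +oo.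
  apply/cvgryPge => A; near=> x.
  rewrite (le_trans _ (expR_ge1Dx x))// -lerBlDl.
  by near: x; apply: nbhs_pinfty_ge; exact: num_real.
apply/cvgNy_compNP.
have -> : gumbel_cdf \o -%R = (fun y => expR (- y)) \o @expR R.
  by apply/funext => x /=; rewrite /gumbel_cdf opprK.
exact: (cvg_comp _ _ expRy (@cvgr_expR R)).
Unshelve. end_near. Qed.

Let gumbel_cdf_y : gumbel_cdf @ +oo --> (1 : R).
Proof.
rewrite -(@expR0 R) -oppr0.
apply: (cvg_comp (fun x : R => - expR (- x)) (@expR R)).
  by apply: cvgN; exact: cvgr_expR.
exact: continuous_expR.
Qed.

HB.instance Definition _ :=
  isCumulativeBounded.Build R 0 1 gumbel_cdf gumbel_cdf_Ny gumbel_cdf_y.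

Definition gumbel_prob : probability (measurableTypeR R) R :=
  lebesgue_stieltjes_measure gumbel_cdf.

Lemma gumbel_probE x : gumbel_prob `]-oo, x]%classic = (gumbel_cdf x)%:E.
Proof. exact: (cdf_lebesgue_stieltjes_id gumbel_cdf). Qed.

End gumbel.

Section spacings.
Context {R : realType} {n : nat}.
Implicit Type x : 'I_n -> R.

(* Ranks start at 0: [order_stat x k] is the (k+1)-st smallest value of x. *)
Definition order_stat x (k : nat) : R := nth 0 (sort <=%R (codom x)) k.

(* [gap x i] is d_(i+1); the last one wraps around the circle. *)
Definition gap x (i : 'I_n) : R :=
  if (i.+1 < n)%N then order_stat x i.+1 - order_stat x i
  else 1 + order_stat x 0 - order_stat x n.-1.

(* The default value 0 of the iterated maximum does not matter for n > 0: the
   gaps other than the last one are nonnegative, and for n = 1 the only gap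
   is 1. *)
Definition max_gap x : R := \big[Num.max/0]_(i < n) gap x i.

End spacings.

Section measurability.
Context {R : realType} {n : nat} {d : measure_display} {T : measurableType d}.
Variable X : 'I_n -> {mfun T >-> R}.

Let order_stat_gt (x : 'I_n -> R) k r : (k < n)%N ->
  (r < order_stat x k) = (\sum_(i < n) (x i <= r)%R%:R <= k%:R :> R).
Proof.
move=> kn; rewrite -natr_sum ler_nat /order_stat.
set s := sort _ _.
have ss : sorted <=%O s by exact: sort_le_sorted.
have -> : (\sum_(i < n) ((x i <= r)%R : nat))%N = count (<= r) s.
  rewrite /s count_sort codomE count_map -sum1_count [RHS]big_mkcond big_enum/=.
  by apply: eq_bigr => i _; case: (_ <= _).
have szs : size s = n by rewrite size_sort size_codom card_ord.
apply/idP/idP => [|kc]; last by apply: nth_count_gt; rewrite // kc szs.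
by rewrite ltNge; apply: contraNT; rewrite -ltnNge => /(nth_count_le 0 ss).
Qed.

Let measurable_order_stat k : (k < n)%N ->
  measurable_fun [set: T] (fun w => order_stat (X ^~ w) k).
Proof.
move=> kn; apply: (measurability _ (RGenOInfty.measurableE R)) => //.
move=> _ [_ [r ->] <-]; rewrite setTI.
pose N w : R := \sum_(i < n) (\1_(X i @^-1` `]-oo, r]) w).
have -> : (fun w => order_stat (X ^~ w) k) @^-1` `]r, +oo[ =
    N @^-1` `]-oo, k%:R].
  have NE w : N w = \sum_(i < n) (X i w <= r)%R%:R.
    apply: eq_bigr => i _; rewrite indicE; congr (_%:R).
    by apply: congr1; apply/idP/idP; rewrite inE/= in_itv.
  by apply/seteqP; split => w /=; rewrite !in_itv/= andbT order_stat_gt// NE.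
have mN : measurable_fun [set: T] N.
  apply: measurable_sum => i; apply: measurable_indic.
  exact: measurable_funPTI.
by rewrite -[_ @^-1` _]setTI; exact: mN.
Qed.

Let measurable_gap i : measurable_fun [set: T] (fun w => gap (X ^~ w) i).
Proof.
have n0 : (0 < n)%N by exact: leq_ltn_trans (ltn_ord i).
rewrite /gap; have [iSn|_] := boolP (i.+1 < n)%N; apply: measurable_funB.
- exact: measurable_order_stat.
- exact: measurable_order_stat.
- by apply: measurable_funD => //; exact: measurable_order_stat.
- by apply: measurable_order_stat; rewrite prednK.
Qed.

Lemma measurable_max_gap :
  measurable_fun [set: T] (fun w => max_gap (X ^~ w)).
Proof.
rewrite /max_gap; elim: (index_enum _) => [|i s ih].
  under eq_fun do rewrite big_nil.
  exact: measurable_cst.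
under eq_fun do rewrite big_cons.
exact: measurable_maxr.
Qed.

(* n d_max - log n *)
Definition normalized_max_gap (w : T) : R :=
  n%:R * max_gap (X ^~ w) - ln n%:R.

Let measurable_normalized_max_gap : measurable_fun [set: T] normalized_max_gap.
Proof.
apply: measurable_funB => //; apply: measurable_funM => //.
exact: measurable_max_gap.
Qed.

HB.instance Definition _ :=
  isMeasurableFun.Build _ _ _ _ normalized_max_gap measurable_normalized_max_gap.

End measurability.

(* Main.v *)
Require Import Defs.
From HB Require Import structures.
From mathcomp Require Import all_boot all_order all_algebra.
From mathcomp Require Import all_classical all_reals all_analysis.
From mathcomp Require Import zify ring lra.

(** The distribution function of the largest gap is known exactly (Stevens):
    for n at least 2 and t > 0,
      P(d_max <= t) = sum_k (-1)^k C(n,k) max(0, 1 - k t)^(n-1),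
    and the theorem is the limit of this formula at t = (x + log n) / n.

    The formula is inclusion-exclusion over the set K of points that are
    followed, clockwise, by an empty arc of length t: the largest gap is at
    most t when there is no such point, and cutting out the k empty arcs that
    follow the points of K leaves n arbitrary points on a circle of perimeter
    1 - k t, whence the probability max(0, 1 - k t)^(n-1).  To make the cutting
    argument elementary the circle is replaced by the cycle of integers modulo
    N, where it is a bijection between finite sets: rotating one point to 0
    ([card_translation_invariant]) and cutting out one arc at a time
    ([card_rooted_clearU]) give an exact count ([card_clear_after]), and
    inclusion-exclusion gives [card_no_clear_after].

    Independence and uniformity enter only through the fact that each of the
    boxes obtained by cutting every axis into N equal cells has probability
    N^-n ([probability_box]).  Knowing the cells of the points determines the
    largest gap up to an error 1/N ([max_gap_le_of_grid],
    [max_gap_gt_of_grid]), and points sharing a cell have vanishing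
    probability, so that letting N grow with n fixed yields the formula
    ([stevens_formula]).

    At t = (x + log n) / n the k-th term of the sum tends to
    (-1)^k exp(-k x) / k!, and it is dominated by exp(1 - x)^k / k!.  Dominated
    convergence for series ([tannery]) then gives
    sum_k (-exp(-x))^k / k! = exp(-exp(-x)) ([cvg_stevens]). *)

Set Implicit Arguments.
Unset Strict Implicit.
Unset Printing Implicit Defensive.
Import Order.TTheory GRing.Theory Num.Theory.
Import numFieldNormedType.Exports.

(** * Counting configurations on a finite cycle *)

Lemma card_bij_in (aT rT : finType) (A : {set aT}) (B : {set rT})
    (f : aT -> rT) (g : rT -> aT) :
  {homo f : x / x \in A >-> x \in B} -> {homo g : y / y \in B >-> y \in A} ->
  {in A, cancel f g} -> {in B, cancel g f} -> #|A| = #|B|.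
Proof.
move=> fAB gBA fK gK; rewrite -(card_in_imset (can_in_inj fK)).
apply: eq_card => y; apply/imsetP/idP => [[x xA ->]|yB]; first exact: fAB.
by exists (g y); rewrite ?gK// gBA.
Qed.

Ltac split_ifs :=
  repeat match goal with |- context [if ?b then _ else _] =>
    let h := fresh in case h: b end;
  lia.

Section clear_arcs.
Variables (I : finType) (m : nat).
Implicit Types (K : {set I}) (i j : I).

(** Configurations of labelled points on the segment {0, ..., N-1} obtained by
    cutting the cycle just before the point [i0]: nothing wraps around, and
    the arc of length [m] after each point of [K] is empty and ends before the
    cycle closes up. *)
Definition rooted_clear N i0 K := [set f : {ffun I -> 'I_N} | [&& injectiveb f,
  f i0 == 0 :> nat & [forall (i | i \in K),
  (f i + m < N)%N && [forall j, (f i < f j)%N ==> (f i + m < f j)%N]]]].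

Lemma rooted_clearP N i0 K (f : {ffun I -> 'I_N}) :
  reflect [/\ injective f, f i0 = 0 :> nat,
     forall i, i \in K -> (f i + m < N)%N &
     forall i, i \in K -> forall j, (f i < f j)%N -> (f i + m < f j)%N]
  (f \in rooted_clear N i0 K).
Proof.
rewrite inE; apply: (iffP and3P).
  move=> [/injectiveP finj /eqP f0 /forall_inP h]; split => // i iK.
    by have /andP[] := h _ iK.
  by have /andP[_ /forallP h' j] := h _ iK; exact/implyP.
move=> [finj f0 h1 h2]; split; [exact/injectiveP|exact/eqP|].
apply/forall_inP => i iK; rewrite h1//=; apply/forallP => j; apply/implyP.
exact: h2.
Qed.

Definition contract N i (f : {ffun I -> 'I_(N.+1 + m)}) : {ffun I -> 'I_N.+1} :=
  [ffun j => inord (if f i < f j then f j - m else f j)].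

Definition expand N i (g : {ffun I -> 'I_N.+1}) : {ffun I -> 'I_(N.+1 + m)} :=
  [ffun j => inord (if g i < g j then g j + m else g j)].

(** Cutting out the empty arc of length [m] after [i], and pasting it back. *)
Lemma card_rooted_clearU N i0 K i : i \notin K ->
  #|rooted_clear (N.+1 + m) i0 (i |: K)| = #|rooted_clear N.+1 i0 K|.
Proof.
move=> iK.
have contractE (f : {ffun I -> 'I_(N.+1 + m)}) j :
    f \in rooted_clear (N.+1 + m) i0 (i |: K) ->
    contract i f j = (if (f i < f j)%N then f j - m else f j)%N :> nat.
  move=> /rooted_clearP[_ _ fN fm]; rewrite ffunE inordK//.
  have := fN _ (setU11 _ _); have := fm _ (setU11 _ _) j; have := ltn_ord (f j).
  by split_ifs.
have expandE (g : {ffun I -> 'I_N.+1}) j :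
    expand i g j = (if (g i < g j)%N then g j + m else g j)%N :> nat.
  rewrite ffunE inordK//; set x := (X in (X < _)%N).
  suff : (x < N.+1 + m)%N by [].
  by rewrite /x; have := ltn_ord (g j); split_ifs.
have expandA (g : {ffun I -> 'I_N.+1}) : g \in rooted_clear N.+1 i0 K ->
    expand i g \in rooted_clear (N.+1 + m) i0 (i |: K).
  move=> gB; have E := expandE g.
  move/rooted_clearP: gB => [ginj g0 gN gm]; apply/rooted_clearP; split.
  + move=> j k /(congr1 val)/=; rewrite !E => jk; apply: ginj; apply: val_inj.
    by move: jk => /=; split_ifs.
  + by rewrite E g0; split_ifs.
  + move=> k /setU1P[->|kK]; rewrite E.
      by rewrite ltnn/=; have := ltn_ord (g i); lia.
    by have := gN _ kK; have := gm _ kK i; split_ifs.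
  + move=> k /setU1P[->|kK] j; rewrite !E.
      by rewrite ltnn/=; split_ifs.
    have := gm _ kK i; have := gm _ kK j.
    by split_ifs.
have contractA (f : {ffun I -> 'I_(N.+1 + m)}) :
    f \in rooted_clear (N.+1 + m) i0 (i |: K) ->
    contract i f \in rooted_clear N.+1 i0 K.
  move=> fA; have E := contractE f ^~ fA.
  move/rooted_clearP: fA => [finj f0 fN fm]; apply/rooted_clearP.
  have iU := setU11 i K; have fiN := fN _ iU; have fim := fm _ iU.
  have neqf k : k \in K -> (f k : nat) <> f i.
    by move=> kK /val_inj/finj ki; rewrite -ki kK in iK.
  split.
  + move=> j k /(congr1 val)/=; rewrite !E => jk; apply: finj; apply: val_inj.
    by have := fim j; have := fim k; move=> ? ?; move: jk => /=; split_ifs.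
  + by rewrite E f0; split_ifs.
  + move=> k kK; rewrite E; have kU : k \in i |: K by rewrite inE kK orbT.
    have := fN _ kU; have := fm _ kU i; have := fim k; have := ltn_ord (f k).
    by have := neqf _ kK; split_ifs.
  + move=> k kK j; rewrite !E; have kU : k \in i |: K by rewrite inE kK orbT.
    have := fm _ kU i; have := fm _ kU j; have := fim k; have := fim j.
    by have := neqf _ kK; split_ifs.
have contractK (f : {ffun I -> 'I_(N.+1 + m)}) :
    f \in rooted_clear (N.+1 + m) i0 (i |: K) -> expand i (contract i f) = f.
  move=> fA; have E := contractE f ^~ fA.
  move/rooted_clearP: fA => [_ _ _ fm]; apply/ffunP => j; apply: val_inj.
  have := fm _ (setU11 _ _) j.
  by rewrite /= expandE !E ltnn; case h: (f i < f j)%N => /=; split_ifs.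
apply: (@card_bij_in _ _ _ _ (contract i) (expand i)).
- exact: contractA.
- exact: expandA.
- exact: contractK.
- move=> g gB; apply/ffunP => j; apply: val_inj => /=.
  rewrite contractE ?expandA// !expandE ltnn.
  by case h: (g i < g j)%N => /=; split_ifs.
Qed.

End clear_arcs.

Section cyclic_clear_arcs.
Variable I : finType.
Implicit Types (K : {set I}) (i j : I).

(** Every configuration is the rotation of exactly one configuration with
    [i0] at 0, and there are [N.+1] rotations. *)
Lemma card_translation_invariant N i0 (Q : pred {ffun I -> 'I_N.+1}) :
  (forall c (f : {ffun I -> 'I_N.+1}),
    Q [ffun j => (f j + c)%R : 'I_N.+1] = Q f) ->
  #|[set f | Q f]| = N.+1 * #|[set f | Q f & f i0 == 0 :> nat]|.
Proof.
move=> Qc; rewrite -sum1_card.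
rewrite (partition_big (fun f : {ffun I -> 'I_N.+1} => f i0) predT)//=.
transitivity (\sum_(c < N.+1) #|[set f | Q f & f i0 == 0 :> nat]|); last first.
  by rewrite sum_nat_const card_ord.
apply: eq_bigr => c _.
pose tr (c : 'I_N.+1) (f : {ffun I -> 'I_N.+1}) : {ffun I -> 'I_N.+1} :=
  [ffun j => (f j + c)%R].
transitivity #|[set f : {ffun I -> 'I_N.+1} | Q f & f i0 == c]|.
  by rewrite -sum1_card; apply: eq_bigl => f; rewrite !inE.
apply: (@card_bij_in _ _ _ _ (tr (- c)%R) (tr c)).
- move=> f; rewrite !inE Qc ffunE => /andP[-> /eqP->].
  by rewrite subrr.
- move=> f; rewrite !inE Qc ffunE => /andP[-> /eqP f0].
  by rewrite (_ : f i0 = 0%R) ?add0r ?eqxx//; exact: ord_inj.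
- by move=> f _; apply/ffunP => j; rewrite !ffunE subrK.
- by move=> f _; apply/ffunP => j; rewrite !ffunE addrK.
Qed.

Lemma injectiveb_translation N c (f : {ffun I -> 'I_N.+1}) :
  injectiveb [ffun j => (f j + c)%R : 'I_N.+1] = injectiveb f.
Proof.
apply/injectiveP/injectiveP => finj j k.
  by move=> jk; apply: finj; rewrite !ffunE jk.
by rewrite !ffunE => /addIr/finj.
Qed.

Definition clear_after m N (f : {ffun I -> 'I_N.+1}) i :=
  [forall j, (j != i) ==> (m < (f j - f i)%R)].

Lemma val_ord_sub N (x y : 'I_N.+1) :
  (x - y)%R = (if y <= x then x - y else N.+1 + x - y) :> nat.
Proof.
have := ltn_ord x; have := ltn_ord y => yN xN.
rewrite /= modnDmr; case: leqP => xy.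
  by rewrite addnBA 1?ltnW// -addnBAC// modnDr modn_small//; lia.
by rewrite addnBA 1?ltnW// addnC modn_small//; lia.
Qed.

Hypothesis I_gt1 : 1 < #|I|.

Lemma card_injectiveb_rooted N i0 :
  #|[set f : {ffun I -> 'I_N.+1} | injectiveb f & f i0 == 0 :> nat]| =
  N ^_ #|I|.-1.
Proof.
apply/eqP; rewrite -(eqn_pmul2l (ltn0Sn N)) -card_translation_invariant.
  by rewrite card_inj_ffuns card_ord -ffactnS prednK//; lia.
exact: injectiveb_translation.
Qed.

(** Cutting out the arcs one at a time leaves injections into a cycle of
    length N.+1 - #|K| m with [i0] at 0.  If the arcs do not fit, the truncated
    subtraction is 0 and so is the falling factorial, as #|I| > 1. *)
Lemma card_rooted_clear m N i0 K :
  #|rooted_clear m N.+1 i0 K| = (N - #|K| * m) ^_ #|I|.-1.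
Proof.
have [k] := ubnP #|K|; elim: k => // k IH in N K *; rewrite ltnS => Kk.
have [->|[i iK]] := set_0Vmem K.
  rewrite cards0 mul0n subn0 -(card_injectiveb_rooted N i0).
  apply: eq_card => f; apply/rooted_clearP/idP => [[finj f0 _ _]|].
    by rewrite inE f0 eqxx andbT; exact/injectiveP.
  by rewrite inE => /andP[/injectiveP finj /eqP f0]; split => // j; rewrite inE.
have -> : #|K| = #|K :\ i|.+1 by rewrite (cardsD1 i K) iK.
have [Nm|mN] := ltnP N m.
  rewrite (_ : (_ - _) = 0); last by rewrite mulSn; lia.
  rewrite ffact_small; last by case: #|I| I_gt1 => [|[]].
  apply: eq_card0 => f; apply/negP => /rooted_clearP[_ _ /(_ i iK) + _].
  lia.
have := @card_rooted_clearU _ m (N - m) i0 (K :\ i) i.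
rewrite setD11 => /(_ isT).
rewrite finset.setD1K// IH; last by have := cardsD1 i K; rewrite iK; lia.
rewrite (_ : (N - m).+1 + m = N.+1); last lia.
move=> ->; congr (_ ^_ _); rewrite mulSn; lia.
Qed.

(** When [i0] sits at 0, an arc that wraps around would meet [i0]; for the arc
    after [i0] itself this needs a second point, hence the assumption on [I]. *)
Lemma mem_rooted_clear m N i0 K (f : {ffun I -> 'I_N.+1}) :
  (f \in rooted_clear m N.+1 i0 K) =
  (injectiveb f && [forall (i | i \in K), clear_after m f i]) &&
  (f i0 == 0 :> nat).
Proof.
apply/rooted_clearP/idP; last first.
  move=> /andP[/andP[/injectiveP finj /forall_inP clr] /eqP f0].
  have clr' i j : i \in K -> j != i -> m < (f j - f i)%R.
    by move=> iK ji; have /forallP/(_ j)/implyP/(_ ji) := clr _ iK.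
  split => // i iK.
    have [ii0|ii0] := eqVneq i i0.
      have [j ji] : exists j, j != i.
        have : 0 < #|predC1 i| by have := cardC1 i; lia.
        by case/card_gt0P => j; exists j.
      have := clr' _ _ iK ji; rewrite val_ord_sub ii0 f0/=.
      by have := ltn_ord (f j); lia.
    rewrite eq_sym in ii0; have := clr' _ _ iK ii0; rewrite val_ord_sub f0.
    have : (f i : nat) <> f i0.
      by move=> /val_inj/finj/eqP; rewrite eq_sym (negbTE ii0).
    by rewrite f0; case: ifP; lia.
  move=> j ij; have ji : j != i by apply: contraTN ij => /eqP->; rewrite ltnn.
  by have := clr' _ _ iK ji; rewrite val_ord_sub; case: ifP; lia.
move=> [finj f0 fN fm]; rewrite f0 eqxx andbT; apply/andP; split.
  exact/injectiveP.
apply/forall_inP => i iK; apply/forallP => j; apply/implyP => ji.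
have neq : (f j : nat) <> f i by move=> /val_inj/finj/eqP; rewrite (negbTE ji).
have := fN _ iK; have := fm _ iK j; rewrite val_ord_sub.
by case h : (f i <= f j); lia.
Qed.

Lemma card_clear_after m N K :
  #|[set f : {ffun I -> 'I_N.+1} |
      injectiveb f & [forall (i | i \in K), clear_after m f i]]| =
  N.+1 * (N - #|K| * m) ^_ #|I|.-1.
Proof.
have /card_gt0P[i0 _] : 0 < #|I| by exact: ltnW.
rewrite (card_translation_invariant i0); last first.
  move=> c f; congr (_ && _); first exact: injectiveb_translation.
  apply: eq_forallb => i; congr (_ ==> _); apply: eq_forallb => j.
  by rewrite !ffunE opprD addrACA subrr addr0.
rewrite -(card_rooted_clear _ _ i0); congr (_ * _); apply: eq_card => f.
by rewrite inE mem_rooted_clear.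
Qed.

(** Inclusion-exclusion: expand the product over [i] of
    1 - [clear_after m f i]. *)
Lemma card_no_clear_after (R : comNzRingType) m N :
  (#|[set f : {ffun I -> 'I_N.+1} |
      injectiveb f & [forall i, ~~ clear_after m f i]]|%:R =
  \sum_(k < #|I|.+1)
    (-1) ^+ k * 'C(#|I|, k)%:R * (N.+1 * (N - k * m) ^_ #|I|.-1)%:R :> R)%R.
Proof.
rewrite -sum1_card natr_sum/=.
transitivity (\sum_(f : {ffun I -> 'I_N.+1} | injectiveb f)
    \prod_i (- (clear_after m f i)%:R + 1) : R)%R.
  rewrite [LHS]big_mkcond [RHS]big_mkcond/=; apply: eq_bigr => f _.
  rewrite inE; case: injectiveP => //= _; case: ifPn => [/forallP h|].
    by rewrite big1// => i _; rewrite (negbTE (h i)) oppr0 add0r.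
  rewrite negb_forall => /existsP[i]; rewrite negbK => hi.
  by rewrite (bigD1 i)//= hi addNr mul0r.
transitivity (\sum_(f : {ffun I -> 'I_N.+1} | injectiveb f) \sum_(K : {set I})
    \prod_i (if i \in K then - (clear_after m f i)%:R else 1) : R)%R.
  by apply: eq_bigr => f _; exact: bigA_distr.
rewrite exchange_big/=.
transitivity (\sum_(K : {set I})
    (-1) ^+ #|K| * (N.+1 * (N - #|K| * m) ^_ #|I|.-1)%:R : R)%R.
  apply: eq_bigr => K _; rewrite -card_clear_after; set A := finset _.
  rewrite -[(#|A|%:R)%R]sumr_const.
  rewrite big_distrr/= [LHS]big_mkcond [RHS]big_mkcond/=; apply: eq_bigr => f _.
  rewrite inE; case: injectiveP => //= _; case: ifPn => [/forall_inP h|].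
    rewrite mulr1 -big_mkcond/= -prodr_const; apply: eq_bigr => i iK.
    by rewrite h.
  rewrite negb_forall_in => /existsP[i /andP[iK hi]].
  by rewrite (bigD1 i)//= iK (negbTE hi) oppr0 mul0r.
rewrite (partition_big (fun K : {set I} => inord #|K| : 'I_(#|I|.+1)) predT)//=.
apply: eq_bigr => k _.
transitivity (\sum_(K in [set K : {set I} | #|K| == k])
    (-1) ^+ k * (N.+1 * (N - k * m) ^_ #|I|.-1)%:R : R)%R.
  apply: eq_big => [K|K /eqP <-].
    rewrite inE; apply/eqP/eqP => [<-|Kk].
      by rewrite inordK// ltnS max_card.
    by apply: val_inj; rewrite /= inordK// ltnS max_card.
  by rewrite inordK// ltnS max_card.
by rewrite sumr_const card_draws -[LHS]mulr_natr mulrAC.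
Qed.

End cyclic_clear_arcs.

Local Open Scope classical_set_scope.
Local Open Scope ring_scope.

(** * Order statistics and the largest gap *)

Section order_statistics.
Context {R : realType} {n : nat}.
Implicit Types (x : 'I_n -> R) (i j : 'I_n).

Let size_sort_codom x : size (sort <=%R (codom x)) = n.
Proof. by rewrite size_sort size_codom card_ord. Qed.

Let sorted_sort_codom x : sorted <=%O (sort <=%R (codom x)).
Proof. exact: sort_le_sorted. Qed.

Lemma order_stat_value x k : (k < n)%N -> exists j, order_stat x k = x j.
Proof.
move=> kn; have : order_stat x k \in codom x.
  by rewrite -(mem_sort <=%R) mem_nth// size_sort_codom.
by case/codomP => j ->; exists j.
Qed.

(** The witness is the last rank at which the value [x i] occurs; with ties,
    [x i] has several ranks. *)
Lemma order_stat_split x i : exists k, [/\ (k < n)%N, order_stat x k <= x i &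
  forall l, (k < l)%N -> (l < n)%N -> x i < order_stat x l].
Proof.
set s := sort <=%R (codom x); set c := count (<= x i) s.
have c_gt0 : (0 < c)%N.
  rewrite -has_count; apply/hasP; exists (x i); last exact: lexx.
  by rewrite mem_sort codom_f.
have cn : (c <= n)%N by rewrite -(size_sort_codom x) count_size.
exists c.-1; split; first lia.
  have : (c.-1 < c)%N by lia.
  by move=> /(nth_count_le 0 (sorted_sort_codom x)).
move=> l cl ln; apply: (nth_count_gt 0 (sorted_sort_codom x)).
by rewrite size_sort_codom ln andbT -/s -/c; lia.
Qed.

Lemma order_stat_le x k l : (k <= l)%N -> (l < n)%N ->
  order_stat x k <= order_stat x l.
Proof.
move=> kl ln; rewrite /order_stat.
apply: (sorted_leq_nth le_trans le_refl) => //; rewrite inE size_sort_codom//.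
exact: leq_ltn_trans ln.
Qed.

Lemma value_order_stat x i : exists2 k, (k < n)%N & order_stat x k = x i.
Proof.
have xis : x i \in sort <=%R (codom x) by rewrite mem_sort codom_f.
exists (index (x i) (sort <=%R (codom x))); last exact: nth_index.
by rewrite -[X in (_ < X)%N](size_sort_codom x) index_mem.
Qed.

Lemma order_stat_next x i k : order_stat x k < x i -> (k < n)%N ->
  (k.+1 < n)%N /\ order_stat x k.+1 <= x i.
Proof.
have [l ln <-] := value_order_stat x i => kl kn.
have kl' : (k < l)%N.
  rewrite ltnNge; apply: contraTN kl => /order_stat_le/(_ kn).
  by rewrite -leNgt.
by split; [exact: leq_ltn_trans ln|exact: order_stat_le].
Qed.

(** This removes the sorting: a largest gap at most [s] means that each point
    is followed within distance [s] by another location, or else by some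
    point after crossing 0. *)
Lemma max_gap_leP x s : 0 <= s -> (forall i, 0 <= x i <= 1) ->
  max_gap x <= s <->
  forall i, exists j, (x i < x j <= x i + s) \/ (1 + x j - x i <= s).
Proof.
move=> s0 x01; split => [/bigmax_leP[_ gs] i|H].
  have [k [kn kxi ki]] := order_stat_split x i.
  have := gs (Ordinal kn) isT; rewrite /gap/=; case: ifPn => kSn gks.
    have [j jE] := order_stat_value x kSn; exists j; left.
    by have := ki _ (ltnSn k) kSn; rewrite -jE => ->/=; lra.
  have n0 : (0 < n)%N by exact: leq_ltn_trans kn.
  have [j jE] := order_stat_value x n0; exists j; right.
  have kE : n.-1 = k by lia.
  by rewrite -jE; rewrite kE in gks; lra.
apply/bigmax_leP; split => // i _; rewrite /gap.
case: ifPn => iSn.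
  have [p pE] := order_stat_value x (ltn_ord i).
  have [q qE] := order_stat_value x iSn.
  have [j [/andP[pj js]|js]] := H p.
    rewrite -pE in pj js.
    by have [_] := order_stat_next pj (ltn_ord i); lra.
  by have := x01 q; have := x01 j; rewrite pE qE; lra.
have n0 : (0 < n)%N by exact: leq_ltn_trans (ltn_ord i).
have n1n : (n.-1 < n)%N by rewrite prednK.
have [p pE] := order_stat_value x n1n.
have [j [/andP[pj js]|js]] := H p.
  by rewrite -pE in pj; have [] := order_stat_next pj n1n; lia.
have [k kn kE] := value_order_stat x j.
have := order_stat_le x (leq0n k) kn.
by rewrite kE pE; lra.
Qed.

End order_statistics.

(** * The asymptotics of the alternating sum *)

Section limits.
Context {R : realType}.
Implicit Types (t x l : R) (a : nat -> nat).

Lemma cvg_positive_part (u : nat -> R) l :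
  u n @[n --> \oo] --> l -> Num.max 0 (u n) @[n --> \oo] --> Num.max 0 l.
Proof.
move=> ul; rewrite maxr_absE.
under eq_fun do rewrite maxr_absE.
apply: cvgM; [apply: cvgD; [apply: cvgD => //; exact: cvg_cst|]|exact: cvg_cst].
by apply: cvg_norm; apply: cvgB => //; exact: cvg_cst.
Qed.

Lemma cvg_exprn (u : nat -> R) l p :
  u n @[n --> \oo] --> l -> u n ^+ p @[n --> \oo] --> l ^+ p.
Proof. by move=> ul; exact: (cvg_comp _ _ ul (@exprn_continuous R p l)). Qed.

(** Truncated subtraction of naturals becomes the positive part. *)
Lemma cvg_natr_ratio_subn a l :
  (a N)%:R / N.+1%:R @[N --> \oo] --> l ->
  (N.+1 - a N)%:R / N.+1%:R @[N --> \oo] --> Num.max 0 (1 - l).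
Proof.
move=> al; under eq_fun => N.
  rewrite (_ : _ / _ = Num.max 0 (1 - (a N)%:R / N.+1%:R)); first over.
  have [aN|Na] := leqP (a N) N.+1.
    rewrite natrB// mulrBl divff// max_r// subr_ge0 ler_pdivrMr// mul1r ler_nat.
    exact: aN.
  rewrite (_ : (N.+1 - a N)%N = 0%N); last lia.
  by rewrite mul0r max_l// subr_le0 ler_pdivlMr// mul1r ler_nat; exact: ltnW.
by apply: cvg_positive_part; apply: cvgB => //; exact: cvg_cst.
Qed.

Lemma cvg_ffact_ratio a l p :
  (a N)%:R / N.+1%:R @[N --> \oo] --> l ->
  ((N.+1 - a N) ^_ p)%:R / N.+1%:R ^+ p @[N --> \oo] -->
    Num.max 0 (1 - l) ^+ p.
Proof.
move=> al; elim: p => [|p IH].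
  rewrite expr0; under eq_fun do rewrite ffactn0 expr0 divr1.
  exact: cvg_cst.
rewrite exprSr; under eq_fun do
  rewrite ffactnSr exprSr natrM invfM mulrACA -subnDA.
apply: cvgM IH _; apply: (@cvg_natr_ratio_subn (fun N => a N + p)%N).
under eq_fun do rewrite natrD mulrDl.
rewrite -[l]addr0; apply: cvgD => //; rewrite -(mulr0 p%:R).
by apply: cvgM; [exact: cvg_cst|exact: cvg_harmonic].
Qed.

Lemma cvg_grid_ratio t a : (forall N, `|(a N)%:R - t * N.+1%:R| <= 2) ->
  (a N)%:R / N.+1%:R @[N --> \oo] --> t.
Proof.
move=> at2; apply/cvgrPdist_le => e e0.
have : 2 * N.+1%:R^-1 @[N --> \oo] --> (0 : R).
  by rewrite -(mulr0 2); apply: cvgM; [exact: cvg_cst|exact: cvg_harmonic].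
move=> /cvgr0_norm_le/(_ _ e0); apply: filterS => N; apply: le_trans.
rewrite distrC (_ : _ - _ = ((a N)%:R - t * N.+1%:R) * N.+1%:R^-1).
  by rewrite !normrM ler_wpM2r// (le_trans (at2 N))// ler_norm.
by field.
Qed.

Lemma cvg_sum_ord K (u : nat -> nat -> R) (v : nat -> R) :
  (forall k, u n k @[n --> \oo] --> v k) ->
  \sum_(k < K) u n k @[n --> \oo] --> \sum_(k < K) v k.
Proof.
move=> uv; elim: K => [|K IH].
  by rewrite big_ord0; under eq_fun do rewrite big_ord0; exact: cvg_cst.
rewrite big_ord_recr; under eq_fun do rewrite big_ord_recr.
exact: cvgD IH (uv K).
Qed.

(** Dominated convergence for series: cut the sums at [K] with the tail of
    [series M] below e / 3. *)
Lemma tannery (u : nat -> nat -> R) (v M : nat -> R) :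
  (forall k, u n k @[n --> \oo] --> v k) ->
  (\forall n \near \oo, forall k, `|u n k| <= M k) -> cvgn (series M) ->
  \sum_(k < n.+1) u n k @[n --> \oo] --> limn (series v).
Proof.
move=> uv uM cM.
have vM k : `|v k| <= M k.
  apply: (cvgr_to_le (cvg_norm (uv k))).
  by apply: filterS uM => n; exact.
have M0 k : 0 <= M k by exact: le_trans (vM k).
have cv : cvgn (series v).
  apply: normed_cvg; apply: (series_le_cvg _ M0 vM cM) => k.
  exact: normr_ge0.
have Mnd : nondecreasing_seq (series M).
  exact: nondecreasing_series.
apply/cvgrPdist_le => e e0.
have e3 : 0 < e / 3 by rewrite divr_gt0.
have [K _ KM] : \forall K \near \oo, limn (series M) - series M K <= e / 3.
  have /cvgrPdist_le/(_ _ e3) := cM; apply: filterS => K.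
  exact: le_trans (ler_norm _).
have tail m : (K <= m)%N -> \sum_(K <= k < m) M k <= e / 3.
  move=> Km; apply: le_trans (KM K (leqnn K)).
  rewrite -sub_series_geq// lerB//; exact: nondecreasing_cvgn_le.
have vtail : `|limn (series v) - series v K| <= e / 3.
  have : `|series v m - series v K| @[m --> \oo] -->
      `|limn (series v) - series v K|.
    by apply: cvg_norm; apply: cvgB => //; exact: cvg_cst.
  move=> /cvgr_to_le; apply; near=> m.
  have Km : (K <= m)%N by near: m; exact: nbhs_infty_ge.
  rewrite sub_series_geq//; apply: le_trans (tail m Km).
  by apply: le_trans (ler_norm_sum _ _ _) _; apply: ler_sum => k _; exact: vM.
have ufin : \sum_(k < K) u n k @[n --> \oo] --> \sum_(k < K) v k.
  by apply: cvg_sum_ord => k; exact: uv.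
near=> n.
have Kn : (K <= n.+1)%N by near: n; exists K => // n /= /leqW.
have un k : `|u n k| <= M k by move: k; near: n.
have h1 : `|\sum_(k < K) v k - \sum_(k < K) u n k| <= e / 3.
  by near: n; move/cvgrPdist_le : ufin; apply.
have h2 : `|\sum_(K <= k < n.+1) u n k| <= e / 3.
  apply: le_trans (tail _ Kn); apply: le_trans (ler_norm_sum _ _ _) _.
  by apply: ler_sum => k _; exact: un.
have -> : \sum_(k < n.+1) u n k =
    \sum_(k < K) u n k + \sum_(K <= k < n.+1) u n k.
  by rewrite -[LHS](big_mkord xpredT) (big_cat_nat (leq0n K) Kn)/= big_mkord.
have sE : series v K = \sum_(k < K) v k by rewrite /series/= big_mkord.
rewrite sE in vtail.
have -> : limn (series v) -
    (\sum_(k < K) u n k + \sum_(K <= k < n.+1) u n k) =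
  (limn (series v) - \sum_(k < K) v k) +
  (\sum_(k < K) v k - \sum_(k < K) u n k) - \sum_(K <= k < n.+1) u n k.
  by ring.
have -> : e = e / 3 + e / 3 + e / 3 by field.
apply: le_trans (ler_normB _ _) _; apply: lerD => //.
by apply: le_trans (ler_normD _ _) _; apply: lerD.
Unshelve. all: by end_near. Qed.

End limits.

Section gumbel_limit.
Context {R : realType}.
Implicit Types (t x : R).

(** The distribution function of the largest gap of [n] points. *)
Definition stevens (n : nat) t : R :=
  \sum_(k < n.+1) (-1) ^+ k * 'C(n, k)%:R * Num.max 0 (1 - k%:R * t) ^+ n.-1.

Lemma near_ln_ge (A : R) : \forall n \near \oo, A <= ln (n%:R : R).
Proof.
have := nbhs_infty_ger (expR A); apply: filterS => n An.
by rewrite -(expRK A) ler_ln// posrE ?expR_gt0// (lt_le_trans (expR_gt0 A)).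
Qed.

(** With y = ln n, the bound n = exp y >= y^3 / 6 makes the quotient
    O(1 / y). *)
Lemma cvg_sqr_ln_div x :
  (x + ln n%:R) ^+ 2 / n%:R @[n --> \oo] --> (0 : R).
Proof.
apply/cvgr0Pnorm_le => e e0; near=> n.
have n0 : (0 < n%:R :> R).
  by rewrite ltr0n; near: n; exact: nbhs_infty_gt.
set y : R := ln n%:R.
have y1 : 1 <= y by rewrite /y; near: n; exact: near_ln_ge.
have yx : `|x| <= y by rewrite /y; near: n; exact: near_ln_ge.
have ye : 24 / e <= y by rewrite /y; near: n; exact: near_ln_ge.
have n_ge : y ^+ 3 / 6 <= n%:R.
  have := @expR_ge1Dxn R y 2 ltac:(lra).
  by rewrite /y lnK ?posrE//; have -> : 3`!%:R = 6 :> R by []; lra.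
have y0 : 0 < y by lra.
rewrite ger0_norm; last by rewrite divr_ge0 ?sqr_ge0// ltW.
rewrite ler_pdivrMr//; apply: le_trans (ler_wpM2l (ltW e0) n_ge).
apply: (@le_trans _ _ (4 * y ^+ 2)).
  have /andP[h1 h2] : - y <= x <= y by rewrite -ler_norml.
  nra.
have : 4 * y ^+ 2 <= 4 * y ^+ 2 * (e * y / 24).
  rewrite ler_peMr; [by []|nra|].
  by rewrite ler_pdivlMr// mul1r mulrC -ler_pdivrMr.
suff -> : 4 * y ^+ 2 * (e * y / 24) = e * (y ^+ 3 / 6) by [].
by field.
Unshelve. all: by end_near. Qed.

Definition gap_scale x (n : nat) : R := (x + ln n%:R) / n%:R.

Lemma gap_scale_sqr x n : (0 < n)%N ->
  n%:R * gap_scale x n ^+ 2 = (x + ln n%:R) ^+ 2 / n%:R.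
Proof.
move=> n0; rewrite /gap_scale; field.
by rewrite pnatr_eq0; lia.
Qed.

Lemma cvg_gap_scale x : gap_scale x n @[n --> \oo] --> (0 : R).
Proof.
apply/cvgr0Pnorm_le => e e0; near=> n.
have n0 : (0 < n)%N by near: n; exact: nbhs_infty_gt.
have n1 : (1 <= n%:R :> R) by rewrite ler1n.
rewrite -(@ler_pXn2r _ 2%N)// ?nnegrE//; last exact: ltW.
rewrite -normrX ger0_norm ?sqr_ge0//.
have : (x + ln n%:R) ^+ 2 / n%:R <= e ^+ 2.
  apply: le_trans (ler_norm _) _; near: n.
  by move/cvgr0Pnorm_le : (cvg_sqr_ln_div x); apply; exact: exprn_gt0.
rewrite -gap_scale_sqr//; apply: le_trans.
by rewrite ler_peMl// sqr_ge0.
Unshelve. all: by end_near. Qed.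

Lemma near_gap_scale_ge0 x : \forall n \near \oo, 0 <= gap_scale x n.
Proof.
have := near_ln_ge (- x); apply: filterS => n h.
by rewrite divr_ge0// -lerBlDl sub0r.
Qed.

Lemma near_gap_scale_le x e : 0 < e -> \forall n \near \oo, gap_scale x n <= e.
Proof.
move=> e0; have /cvgr0Pnorm_le/(_ _ e0) := cvg_gap_scale x.
by apply: filterS => n; apply: le_trans; exact: ler_norm.
Qed.

(** The scale (x + ln n) / n is chosen to cancel the number [n] of possible
    long gaps. *)
Lemma expR_gap_scale x n : (0 < n)%N ->
  n%:R * expR (- (n.-1%:R * gap_scale x n)) = expR (- x + gap_scale x n).
Proof.
case: n => // n _; rewrite -[X in X * _]lnK ?posrE//= -expRD; congr expR.
rewrite /gap_scale -[n in RHS]/(n.+1.-1) -[in RHS]natr1 -[in LHS]natr1.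
field; by rewrite natr1.
Qed.

Lemma pos_part_pow_le k n t :
  Num.max 0 (1 - k%:R * t) ^+ n <= expR (- (n%:R * t)) ^+ k.
Proof.
rewrite -expRM_natl (_ : k%:R * - _ = n%:R * (- (k%:R * t))); last by ring.
rewrite expRM_natl lerXn2r ?nnegrE ?expR_ge0 ?le_max ?lexx//.
by rewrite ge_max expR_ge0/= expR_ge1Dx.
Qed.

(** For 0 <= u <= 1/2 one has 1 - u >= exp(- u - 2 u^2), a consequence of
    1 / (1 - u) <= 1 + u + 2 u^2. *)
Lemma pos_part_pow_ge k n t : 0 <= t -> k%:R * t <= 2^-1 ->
  expR (- (n%:R * t)) ^+ k * expR (- (2 * k%:R ^+ 2 * (n%:R * t ^+ 2))) <=
  Num.max 0 (1 - k%:R * t) ^+ n.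
Proof.
move=> t0 kt; set u := k%:R * t in kt *.
have u0 : 0 <= u by rewrite mulr_ge0.
rewrite -expRM_natl -expRD.
have -> : k%:R * - (n%:R * t) - 2 * k%:R ^+ 2 * (n%:R * t ^+ 2) =
    n%:R * (- (u + 2 * u ^+ 2)) by rewrite /u; ring.
rewrite expRM_natl lerXn2r ?nnegrE ?expR_ge0 ?le_max ?lexx//.
apply/orP; right; rewrite expRN.
have u1 : 0 < 1 - u by lra.
rewrite invf_ple ?posrE ?expR_gt0//.
apply: le_trans (expR_ge1Dx _).
rewrite -[X in X <= _]div1r ler_pdivrMr//.
have -> : (1 + (u + 2 * u ^+ 2)) * (1 - u) = 1 + u ^+ 2 * (1 - 2 * u) by ring.
by rewrite lerDl mulr_ge0 ?sqr_ge0//; lra.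
Qed.

Lemma cvg_expR_comp (u : nat -> R) (l : R) :
  u n @[n --> \oo] --> l -> expR (u n) @[n --> \oo] --> expR l.
Proof. by move=> ul; exact: (cvg_comp _ _ ul (@continuous_expR R l)). Qed.

Lemma cvg_ffact_ratio1 k :
  (n ^_ k)%:R / n%:R ^+ k @[n --> \oo] --> (1 : R).
Proof.
rewrite -(cvg_shiftS (fun n => (n ^_ k)%:R / n%:R ^+ k : R)).
have h0 : 0%:R / N.+1%:R @[N --> \oo] --> (0 : R).
  by under eq_fun do rewrite mul0r; exact: cvg_cst.
have := @cvg_ffact_ratio R (fun=> 0%N) 0 k h0.
by rewrite subr0 max_r ?ler01// expr1n.
Qed.

(** The upper bound 1 - u <= exp(-u) is already sharp in the limit; the
    quadratic correction of the lower bound is negligible since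
    n (gap_scale x n)^2 tends to 0. *)
Lemma cvg_clear_probability x k :
  n%:R ^+ k * Num.max 0 (1 - k%:R * gap_scale x n) ^+ n.-1 @[n --> \oo] -->
  expR (- x) ^+ k.
Proof.
have upper : expR (- x + gap_scale x n) ^+ k @[n --> \oo] --> expR (- x) ^+ k.
  apply: cvg_exprn; apply: cvg_expR_comp; rewrite -[X in _ --> X]addr0.
  by apply: cvgD; [exact: cvg_cst|exact: cvg_gap_scale].
have lower : expR (- x + gap_scale x n) ^+ k *
    expR (- (2 * k%:R ^+ 2 * ((x + ln n%:R) ^+ 2 / n%:R))) @[n --> \oo] -->
    expR (- x) ^+ k.
  have h : expR (- (2 * k%:R ^+ 2 * ((x + ln n%:R) ^+ 2 / n%:R)))
      @[n --> \oo] --> expR (- (2 * k%:R ^+ 2 * 0)).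
    apply: cvg_expR_comp; apply: cvgN; apply: cvgM; first exact: cvg_cst.
    exact: cvg_sqr_ln_div.
  rewrite mulr0 oppr0 expR0 in h; rewrite -[X in _ --> X]mulr1.
  exact: cvgM upper h.
apply: (squeeze_cvgr _ lower upper); near=> n.
have n0 : (0 < n)%N by near: n; exact: nbhs_infty_gt.
have t0 : 0 <= gap_scale x n by near: n; exact: near_gap_scale_ge0.
have kt : k%:R * gap_scale x n <= 2^-1.
  have : gap_scale x n <= (2 * k.+1%:R)^-1.
    by near: n; apply: near_gap_scale_le; rewrite invr_gt0.
  rewrite invfM => h; apply: (@le_trans _ _ (k.+1%:R * gap_scale x n)).
    by rewrite ler_wpM2r// ler_nat.
  by rewrite mulrC -ler_pdivlMr.
rewrite -expR_gap_scale// exprMn; apply/andP; split; last first.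
  by rewrite ler_wpM2l ?exprn_ge0//; exact: pos_part_pow_le.
rewrite -[leLHS]mulrA ler_wpM2l ?exprn_ge0//.
apply: le_trans (pos_part_pow_ge _ t0 kt).
rewrite ler_wpM2l ?exprn_ge0 ?expR_ge0// ler_expR lerN2.
rewrite ler_wpM2l ?mulr_ge0 ?sqr_ge0// -gap_scale_sqr//.
by rewrite ler_wpM2r ?sqr_ge0// ler_nat leq_pred.
Unshelve. all: by end_near. Qed.

Lemma natr_bin (n k : nat) : 'C(n, k)%:R = (n ^_ k)%:R / k`!%:R :> R.
Proof. by rewrite -bin_ffact natrM mulfK// pnatr_eq0 -lt0n fact_gt0. Qed.

Lemma ffact_le_expn (n k : nat) : (n ^_ k <= n ^ k)%N.
Proof.
elim: k => [|k IH]; first by rewrite ffactn0 expn0.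
by rewrite ffactnSr expnSr leq_mul// leq_subr.
Qed.

Lemma cvg_stevens x :
  stevens n (gap_scale x n) @[n --> \oo] --> expR (- expR (- x)).
Proof.
apply: (@tannery R (fun n k => (-1) ^+ k * 'C(n, k)%:R *
    Num.max 0 (1 - k%:R * gap_scale x n) ^+ n.-1)
  (exp_coeff (- expR (- x))) (exp_coeff (expR (1 - x)))).
- move=> k; rewrite /exp_coeff/=.
  rewrite (_ : _ / _ = (-1) ^+ k * (1 / k`!%:R) * expR (- x) ^+ k); last first.
    by rewrite [in LHS]exprNn div1r mulrAC.
  have h : (-1) ^+ k * ((n ^_ k)%:R / n%:R ^+ k * k`!%:R^-1) *
      (n%:R ^+ k * Num.max 0 (1 - k%:R * gap_scale x n) ^+ n.-1)
      @[n --> \oo] -->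
      (-1) ^+ k * (1 / k`!%:R) * expR (- x) ^+ k.
    apply: cvgM; last exact: cvg_clear_probability.
    apply: cvgM; first exact: cvg_cst.
    by apply: cvgM; [exact: cvg_ffact_ratio1|exact: cvg_cst].
  apply: cvg_trans h; apply: near_eq_cvg; near=> n.
  have n0 : (n%:R != 0 :> R).
    by rewrite pnatr_eq0 -lt0n; near: n; exact: nbhs_infty_gt.
  rewrite natr_bin; set M := Num.max _ _ ^+ _.
  by field; rewrite pnatr_eq0 -lt0n fact_gt0/= expf_neq0.
- near=> n => k.
  have n0 : (0 < n)%N by near: n; exact: nbhs_infty_gt.
  have t1 : gap_scale x n <= 1 by near: n; exact: near_gap_scale_le.
  rewrite !normrM normrX normrN1 expr1n mul1r normr_nat ger0_norm; last first.
    by rewrite exprn_ge0// le_max lexx.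
  rewrite natr_bin /exp_coeff/= mulrAC ler_wpM2r ?invr_ge0//.
  apply: (@le_trans _ _ (n%:R ^+ k * expR (- (n.-1%:R * gap_scale x n)) ^+ k)).
    apply: ler_pM => //; last exact: pos_part_pow_le.
      by rewrite exprn_ge0// le_max lexx.
    by rewrite -natrX ler_nat; exact: ffact_le_expn.
  rewrite -exprMn expR_gap_scale// lerXn2r ?nnegrE ?expR_ge0// ler_expR.
  by lra.
- exact: is_cvg_series_exp_coeff.
Unshelve. all: by end_near. Qed.

End gumbel_limit.

(** * From points on the circle to grid cells *)

Section grid.
Context {R : realType} {n N : nat}.
Implicit Types (x : 'I_n -> R) (f : {ffun 'I_n -> 'I_N.+1}).

Definition cell (c : 'I_N.+1) : set R :=
  `[c%:R / N.+1%:R, c.+1%:R / N.+1%:R[%classic.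

Lemma cellP c (y : R) : cell c y <-> c%:R <= N.+1%:R * y < c.+1%:R.
Proof.
by rewrite /cell/= in_itv/= ler_pdivrMr// ltr_pdivlMr// [y * _]mulrC.
Qed.

Lemma cell_inj c c' y : cell c y -> cell c' y -> c = c'.
Proof.
move=> /cellP/andP[h1 h2] /cellP/andP[h3 h4]; apply: ord_inj.
have : (c%:R < c'.+1%:R :> R) by exact: le_lt_trans h1 h4.
have : (c'%:R < c.+1%:R :> R) by exact: le_lt_trans h3 h2.
rewrite !ltr_nat; lia.
Qed.

Lemma cell_ge0_le1 c y : cell c y -> 0 <= y <= 1.
Proof.
move=> /cellP/andP[h1 h2].
have N0 : (0 < N.+1%:R :> R) by [].
rewrite -(pmulr_rge0 _ N0) (le_trans _ h1)//=.
rewrite -(ler_pM2l N0) mulr1 (le_trans (ltW h2))// ler_nat; exact: ltn_ord.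
Qed.

(** Distances between points and between their cells, in units of
    1 / N.+1, differ by less than one. *)
Lemma max_gap_le_of_grid m f x t : 0 <= t -> injective f ->
  (forall i, cell (f i) (x i)) -> (forall i, ~~ clear_after m f i) ->
  m.+1%:R / N.+1%:R <= t -> max_gap x <= t.
Proof.
move=> t0 finj fx fm; rewrite ler_pdivrMr// => mt.
have N0 : (0 < N.+1%:R :> R) by [].
apply/max_gap_leP => // [i|i]; first exact: cell_ge0_le1 (fx i).
have [j ji fijm] : exists2 j : 'I_n, j != i & ((f j - f i)%R <= m)%N.
  have := fm i; rewrite negb_forall => /existsP[j].
  by rewrite negb_imply -leqNgt => /andP[]; exists j.
have neq : (f j : nat) <> f i by move=> /ord_inj/finj/eqP; rewrite (negbTE ji).
exists j; have /cellP/andP[i1 i2] := fx i; have /cellP/andP[j1 j2] := fx j.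
move: fijm; rewrite val_ord_sub; case ij : (f i <= f j)%N => fijm; [left|right].
  have h1 : ((f i).+1%:R <= (f j)%:R :> R).
    by rewrite ler_nat; clear -ij fijm neq; lia.
  have h2 : ((f j).+1%:R <= m.+1%:R + (f i)%:R :> R).
    by rewrite -natrD ler_nat; clear -ij fijm neq; lia.
  rewrite -(ltr_pM2l N0) (lt_le_trans i2 (le_trans h1 j1))/=.
  rewrite -(ler_pM2l N0) mulrDr [_ * t]mulrC; lra.
have h2 : (N.+1%:R + (f j).+1%:R <= m.+1%:R + (f i)%:R :> R).
  by rewrite -!natrD ler_nat; have := ltn_ord (f i); clear -fijm; lia.
rewrite -(ler_pM2l N0) mulrBr mulrDr mulr1 [_ * t]mulrC; lra.
Qed.

Lemma max_gap_gt_of_grid m f x t i : (1 < n)%N -> 0 <= t -> injective f ->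
  (forall i, cell (f i) (x i)) -> clear_after m f i ->
  t <= m%:R / N.+1%:R -> t < max_gap x.
Proof.
move=> n1 t0 finj fx /forallP fm; rewrite ler_pdivlMr// => tm.
have N0 : (0 < N.+1%:R :> R) by [].
have fm' (j : 'I_n) : j != i -> (m < (f j - f i)%R)%N by have /implyP := fm j.
(* A second point exists and lies beyond the arc of length m after f i. *)
have mN : (m < N.+1)%N.
  have : (0 < #|predC1 i|)%N by have := cardC1 i; rewrite card_ord; lia.
  case/card_gt0P => j; rewrite inE/= => /fm'/ltn_trans; apply; exact: ltn_ord.
have t1 : t < 1.
  by rewrite -(ltr_pM2r N0) (le_lt_trans tm)// mul1r ltr_nat.
rewrite ltNge; apply/negP => /(max_gap_leP t0 (fun i => cell_ge0_le1 (fx i))).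
move=> /(_ i)[j]; have [->|ji] := eqVneq j i; first by rewrite ltxx/=; lra.
have neq : (f j : nat) <> f i by move=> /ord_inj/finj/eqP; rewrite (negbTE ji).
have := fm' j ji; rewrite val_ord_sub.
have /cellP/andP[i1 i2] := fx i; have /cellP/andP[j1 j2] := fx j.
case ij : (f i <= f j)%N => fijm [/andP[xij xt]|xt].
- have : (m%:R + (f i).+1%:R <= (f j)%:R :> R).
    by rewrite -natrD ler_nat; clear -ij fijm neq; lia.
  by move: xt; rewrite -(ler_pM2l N0) mulrDr [_ * t]mulrC; lra.
- have h1 : ((f i).+1%:R <= (f j)%:R :> R).
    by rewrite ler_nat; clear -ij fijm neq; lia.
  by have := lt_le_trans i2 (le_trans h1 j1); rewrite ltr_pM2l//; lra.
- have h1 : ((f j).+1%:R <= (f i)%:R :> R).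
    by rewrite ler_nat; clear -ij neq; lia.
  by have := lt_le_trans j2 (le_trans h1 i1); rewrite ltr_pM2l//; lra.
- have : (m%:R + (f i).+1%:R <= N.+1%:R + (f j)%:R :> R).
    by rewrite -!natrD ler_nat; have := ltn_ord (f i); clear -fijm; lia.
  by move: xt; rewrite -(ler_pM2l N0) mulrBr mulrDr mulr1 [_ * t]mulrC; lra.
Qed.

End grid.

Lemma uniform_prob01_ico (R : realType) (a b : R) : 0 <= a -> a < b -> b <= 1 ->
  uniform_prob (@ltr01 R) `[a, b[ = (b - a)%:E.
Proof.
move=> a0 ab b1; rewrite /uniform_prob.
rewrite (eq_integral (fun=> 1%:E)).
  by rewrite integral_cst//= mul1e lebesgue_measure_itv/= lte_fin ab.
move=> y; rewrite inE/= in_itv/= => /andP[ay yb].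
by rewrite /uniform_pdf subr0 invr1 (le_trans a0 ay)/= (le_trans (ltW yb) b1).
Qed.

(** * Stevens' formula *)

Section stevens_formula.
Context {R : realType} {n : nat} {d : measure_display} {T : measurableType d}.
Context {P : probability T R} {X : 'I_n -> {RV P >-> R}}.
Hypothesis X_indep : mutually_independent X.
Hypothesis X_unif : forall i, uniform01_distributed (X i).
Hypothesis n_gt1 : (1 < n)%N.

Definition box N (f : {ffun 'I_n -> 'I_N.+1}) : set T :=
  [set w | forall i, cell (f i) (X i w)].

Lemma measurable_box N f : measurable (@box N f).
Proof.
rewrite (_ : box f = \bigcap_(i in [set: 'I_n]) (X i @^-1` cell (f i))).
  apply: fin_bigcap_measurable => // i _.
  by apply: measurable_funPTI; exact: measurable_itv.
by apply/seteqP; split => w /= h i; [move=> _; exact: h|exact: (h i)].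
Qed.

Lemma probability_box N f : P (@box N f) = (N.+1%:R ^- n)%:E.
Proof.
have -> : box f = \bigcap_(i in [set` [set: 'I_n]%SET]) (X i @^-1` cell (f i)).
  apply/seteqP; split => w /= h i; first by move=> _; exact: h.
  by apply: h; rewrite /= inE.
rewrite X_indep; last by move=> i _; exact: measurable_itv.
under eq_bigr => i _.
  rewrite (_ : P _ = (N.+1%:R^-1)%:E); last first.
    have := @X_unif i (cell (f i)) (measurable_itv _).
    rewrite /distribution/pushforward => -> //.
    rewrite uniform_prob01_ico.
    + by rewrite -mulrBl -natrB// subSnn div1r.
    + by rewrite divr_ge0.
    + by rewrite ltr_pM2r// ltr_nat.
    + by rewrite ler_pdivrMr// mul1r ler_nat ltn_ord.
  over.
rewrite prodEFin prodr_const cardsT card_ord exprVn//.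
Qed.

Definition boxes N (G : {set {ffun 'I_n -> 'I_N.+1}}) : set T :=
  \bigcup_(f in [set` G]) box f.

Lemma measurable_boxes N G : measurable (@boxes N G).
Proof. by apply: fin_bigcup_measurable => // f _; exact: measurable_box. Qed.

Lemma probability_boxes N G :
  P (@boxes N G) = (#|G|%:R / N.+1%:R ^+ n)%:E.
Proof.
rewrite measure_fin_bigcup//; last 2 first.
- move=> f g _ _ [w [fw gw]]; apply/ffunP => i.
  exact: cell_inj (fw i) (gw i).
- by move=> f _; exact: measurable_box.
rewrite -(@bigfs _ _ _ _ (index_enum {ffun 'I_n -> 'I_N.+1}))//=; last 2 first.
- exact: index_enum_uniq.
- by move=> f _; rewrite mem_index_enum.
under eq_bigr do rewrite probability_box.
by rewrite sumEFin sumr_const mulr_natl.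
Qed.

Definition short_gap_grid m N := [set f : {ffun 'I_n -> 'I_N.+1} |
  injectiveb f & [forall i, ~~ clear_after m f i]]%SET.

Definition long_gap_grid m N := [set f : {ffun 'I_n -> 'I_N.+1} |
  injectiveb f & ~~ [forall i, ~~ clear_after m f i]]%SET.

Lemma card_short_long_gap_grid m N :
  (#|short_gap_grid m N| + #|long_gap_grid m N| = N.+1 ^_ n)%N.
Proof.
have := card_inj_ffuns 'I_n 'I_N.+1; rewrite !card_ord => <-.
rewrite -[RHS](cardsID [set f | [forall i, ~~ clear_after m f i]]%SET).
by congr (_ + _)%N; apply: eq_card => f; rewrite !inE// andbC.
Qed.

Lemma measurable_max_gap_le t : measurable [set w | max_gap (X ^~ w) <= t].
Proof.
have := @measurable_max_gap _ _ _ _ X measurableT _ (measurable_itv `]-oo, t]).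
by rewrite setTI; congr measurable; apply/seteqP; split => w /=; rewrite in_itv.
Qed.

Lemma probability_max_gap_ge m N t : 0 <= t -> m.+1%:R / N.+1%:R <= t ->
  #|short_gap_grid m N|%:R / N.+1%:R ^+ n <=
  fine (P [set w | max_gap (X ^~ w) <= t]).
Proof.
move=> t0 mt; have mE := measurable_max_gap_le t.
rewrite -lee_fin fineK ?fin_num_measure//.
rewrite -probability_boxes; apply: le_measure; rewrite ?inE.
- exact: measurable_boxes.
- exact: mE.
move=> w [f /=]; rewrite inE => /andP[/injectiveP finj /forallP fm] fw.
exact: (max_gap_le_of_grid t0 finj fw fm mt).
Qed.

(** The boxes of configurations sharing a cell are decided neither way, so the
    bound comes from the complement, which contains all boxes with a long
    gap. *)
Lemma probability_max_gap_le m N t : 0 <= t -> t <= m%:R / N.+1%:R ->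
  fine (P [set w | max_gap (X ^~ w) <= t]) <=
  1 - #|long_gap_grid m N|%:R / N.+1%:R ^+ n.
Proof.
move=> t0 tm; have mE := measurable_max_gap_le t.
rewrite -lee_fin fineK ?fin_num_measure//.
rewrite EFinB -probability_boxes -probability_setC;
  last exact: measurable_boxes.
apply: le_measure; rewrite ?inE.
- exact: mE.
- by apply: measurableC; exact: measurable_boxes.
move=> w /= wt [f /=]; rewrite inE => /andP[/injectiveP finj].
rewrite negb_forall => /existsP[i]; rewrite negbK => fi fw.
by have := max_gap_gt_of_grid n_gt1 t0 finj fw fi tm; rewrite ltNge wt.
Qed.

Lemma cvg_short_gap_grid (m : nat -> nat) (t : R) :
  (m N)%:R / N.+1%:R @[N --> \oo] --> t ->
  #|short_gap_grid (m N) N|%:R / N.+1%:R ^+ n @[N --> \oo] --> stevens n t.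
Proof.
move=> mt; rewrite /stevens.
have -> : (fun N => #|short_gap_grid (m N) N|%:R / N.+1%:R ^+ n : R) =
    (fun N => \sum_(k < n.+1) (-1) ^+ k * 'C(n, k)%:R *
      ((N.+1 - (k * m N).+1) ^_ n.-1)%:R / N.+1%:R ^+ n.-1).
  apply/funext => N; rewrite card_no_clear_after card_ord// mulr_suml.
  apply: eq_bigr => k _; rewrite natrM subSS.
  have -> : N.+1%:R ^+ n = N.+1%:R * N.+1%:R ^+ n.-1 :> R.
    by rewrite -exprS prednK// ltnW.
  by field; rewrite expf_neq0 ?nat1r ?pnatr_eq0.
refine (@cvg_sum_ord R n.+1 (fun N k => (-1) ^+ k * 'C(n, k)%:R *
      ((N.+1 - (k * m N).+1) ^_ n.-1)%:R / N.+1%:R ^+ n.-1)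
  (fun k => (-1) ^+ k * 'C(n, k)%:R * Num.max 0 (1 - k%:R * t) ^+ n.-1) _) => k.
under eq_fun do rewrite -mulrA.
apply: cvgM; first exact: cvg_cst.
apply: (@cvg_ffact_ratio R (fun N => (k * m N).+1)).
under eq_fun do rewrite -natr1 mulrDl natrM -mulrA mul1r.
rewrite -[k%:R * t]addr0; apply: cvgD; last exact: cvg_harmonic.
by apply: cvgM => //; exact: cvg_cst.
Qed.

(** With m close to t (N + 1) both bounds on the probability tend to
    [stevens n t] as the grid is refined: the upper one adds the fraction of
    configurations with two points in the same cell, which vanishes. *)
Lemma stevens_formula t : 0 < t ->
  P [set w | max_gap (X ^~ w) <= t] = (stevens n t)%:E.
Proof.
move=> t0; rewrite -[LHS]fineK ?fin_num_measure//; last first.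
  exact: measurable_max_gap_le.
congr EFin; set p := fine _.
(* The lower bound needs m + 1 <= t (N + 1) and the upper one
   t (N + 1) <= m, whence the shifts of the integer part by one. *)
pose m N := Num.truncn (t * N.+1%:R).
have m_itv N : (m N)%:R <= t * N.+1%:R < (m N).+1%:R.
  by apply: truncn_itv; rewrite mulr_ge0// ltW.
have lower : #|short_gap_grid (m N).-1 N|%:R / N.+1%:R ^+ n @[N --> \oo] -->
    stevens n t.
  apply: cvg_short_gap_grid; apply: cvg_grid_ratio => N.
  have /andP[] := m_itv N; case: (m N) => [|k]/=.
    by move=> h1 h2; rewrite ler_norml; lra.
  by rewrite -[k.+2%:R]natr1 -[k.+1%:R]natr1 => h1 h2; rewrite ler_norml; lra.
have upper : #|short_gap_grid (m N).+1 N|%:R / N.+1%:R ^+ n +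
    (1 - (N.+1 ^_ n)%:R / N.+1%:R ^+ n) @[N --> \oo] --> stevens n t.
  rewrite -[X in _ --> X]addr0; apply: cvgD.
    apply: cvg_short_gap_grid; apply: cvg_grid_ratio => N.
    have /andP[] := m_itv N.
    by rewrite -[(m N).+1%:R]natr1 => h1 h2; rewrite ler_norml; lra.
  rewrite -(subrr (1 : R)); apply: cvgB; first exact: cvg_cst.
  have := @cvg_ffact_ratio1 R n.
  by rewrite -(cvg_shiftS (fun N => (N ^_ n)%:R / N%:R ^+ n : R)).
apply/eqP; rewrite eq_le; apply/andP; split.
  apply: (cvgr_to_ge upper); near=> N.
  have := @probability_max_gap_le (m N).+1 N t (ltW t0).
  rewrite ler_pdivlMr// => /(_ _)/le_trans; apply.
    by have /andP[_ /ltW] := m_itv N.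
  have -> : (N.+1 ^_ n)%:R =
      #|short_gap_grid (m N).+1 N|%:R + #|long_gap_grid (m N).+1 N|%:R :> R.
    by rewrite -natrD card_short_long_gap_grid.
  by rewrite mulrDl; lra.
apply: (cvgr_to_le lower); near=> N.
apply: probability_max_gap_ge; first exact: ltW.
have N1 : 1 <= t * N.+1%:R.
  rewrite -ler_pdivrMl// mulr1 ltW// -natr1 ltr_pwDr//; near: N.
  exact: nbhs_infty_ger.
have m0 : (0 < m N)%N by rewrite truncn_gt0.
by rewrite prednK// ler_pdivrMr//; have /andP[] := m_itv N.
Unshelve. all: by end_near. Qed.

End stevens_formula.

(** * Convergence to the Gumbel law *)

Theorem corollary1 (R : realType) (d : nat -> measure_display)
    (T : forall n : nat, measurableType (d n))
    (P : forall n : nat, probability (T n) R)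
    (X : forall n : nat, 'I_n -> {RV (P n) >-> R})
    (X_indep : forall n : nat, mutually_independent (X n))
    (X_unif : forall (n : nat) (i : 'I_n), uniform01_distributed (X n i)) :
  cvg_in_law P (fun n : nat => normalized_max_gap (X n)) gumbel_prob.
Proof.
move=> x _; rewrite gumbel_probE /gumbel_cdf.
have h := @cvg_stevens R x.
suff : (stevens n (gap_scale x n))%:E @[n --> \oo] --> (expR (- expR (- x)))%:E.
  move=> h'; apply: cvg_trans h'; apply: near_eq_cvg; near=> n.
  have n1 : (1 < n)%N by near: n; exact: nbhs_infty_gt.
  have n0 : (0 < n%:R :> R) by rewrite ltr0n ltnW.
  rewrite -(stevens_formula (X_indep n) (X_unif n))//.
    rewrite /cdf /distribution/pushforward; congr (P n _).
    apply/seteqP; split => w /=; rewrite in_itv/= /normalized_max_gap/gap_scale.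
      by rewrite ler_pdivlMr// lerBlDr mulrC.
    by rewrite ler_pdivlMr// lerBlDr mulrC.
  rewrite /gap_scale divr_gt0// -ltrBlDl sub0r.
  apply: (@lt_le_trans _ _ (- x + 1)); first by rewrite ltrDl.
  by near: n; exact: near_ln_ge.
by apply/fine_cvgP; split => //; exact: nearW.
Unshelve. all: by end_near. Qed.
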